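(* Let $G$ be a graph with $n$ vertices, maximum degree $\Delta$, and treewidth $k$. Then the distance-number of $G$ satisfies $\mathrm{dn}(G)\in\mathcal{O}(\Delta^4k^3\log n)$.
   Context: A drawing of a graph maps vertices to distinct points in the plane and each edge to the open straight-line segment joining its endpoints, such that no vertex lies in the interior of an edge. The distance-number $\mathrm{dn}(G)$ is the minimum number of distinct edge-lengths over all drawings of $G$. *)

(* Defs.v *)
From HB Require Import structures.
From mathcomp Require Import all_boot all_order all_algebra.
From mathcomp Require Import boolp reals exp.
From mathcomp Require Import ring.

Set Implicit Arguments.
Unset Strict Implicit.
Unset Printing Implicit Defensive.

Import Order.TTheory GRing.Theory Num.Theory.

Local Open Scope ring_scope.

Record sgraph := SGraph {
  vertex :> finType;
  edge : rel vertex;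
  edge_sym : symmetric edge;
  edge_irrefl : irreflexive edge }.

Arguments edge {_} _ _.

Definition max_degree (G : sgraph) : nat :=
  (\max_(v : G) #|[set w | edge v w]|)%N.

Definition connected (G : sgraph) : Prop :=
  (0 < #|G|)%N /\ forall x y : G, connect edge x y.

(* [ucycle edge [:: x; y]] holds for every edge xy, whence the bound on the
   length. *)
Definition acyclic (G : sgraph) : Prop :=
  forall c : seq G, (2 < size c)%N -> ~ ucycle edge c.

Definition is_tree (G : sgraph) : Prop := connected G /\ acyclic G.

Definition induces_connected (G : sgraph) (S : {set G}) : Prop :=
  S != set0 /\
  forall x y, x \in S -> y \in S ->
    connect [rel u v | [&& u \in S, v \in S & edge u v]] x y.

Definition tree_decomposition (G T : sgraph) (bag : T -> {set G}) : Prop :=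
  [/\ is_tree T,
      forall v w : G, edge v w -> exists t, v \in bag t /\ w \in bag t
    & forall v : G, induces_connected [set t | v \in bag t]].

(* The predecessor is truncated: the graph without vertices gets width 0
   instead of -1. *)
Definition width (G T : sgraph) (bag : T -> {set G}) : nat :=
  (\max_(t : T) #|bag t|).-1.

Definition has_decomposition_of_width (G : sgraph) (k : nat) : Prop :=
  exists (T : sgraph) (bag : T -> {set G}),
    tree_decomposition bag /\ width bag = k.

Lemma ex_decomposition_of_width (G : sgraph) :
  exists k, `[< has_decomposition_of_width G k >].
Proof.
pose T := @SGraph unit (fun _ _ => false) (fun _ _ => erefl) (fun _ => erefl).
exists (width (fun _ : T => [set: G])); apply/asboolP; exists T, (fun _ => setT).
split=> //; split.
- split; first by split=> [|[] []]; [rewrite card_unit | exact: connect0].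
  by move=> [|[] [|[] c]] // _ /andP[_ /andP[]].
- by move=> v w _; exists tt; rewrite !inE.
- move=> v; split; first by apply/set0Pn; exists tt; rewrite !inE.
  by move=> [] [] _ _; exact: connect0.
Qed.

Definition treewidth (G : sgraph) : nat := ex_minn (ex_decomposition_of_width G).

Section Drawings.
Variable R : realType.

(* Not the norm of ['rV[R]_2], which is the supremum norm. *)
Definition distance (p q : 'rV[R]_2) : R :=
  Num.sqrt (\sum_(i < 2) (p 0 i - q 0 i) ^+ 2).

Definition open_segment (p q z : 'rV[R]_2) : Prop :=
  exists t : R, 0 < t < 1 /\ z = (1 - t) *: p + t *: q.

(* Edges are drawn straight, so the positions of the vertices determine the
   whole drawing.  Edges may cross and overlap. *)
Definition drawing (G : sgraph) (p : G -> 'rV[R]_2) : Prop :=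
  injective p /\
  forall u v w : G, edge u v -> ~ open_segment (p u) (p v) (p w).

Definition edge_lengths (G : sgraph) (p : G -> 'rV[R]_2) : seq R :=
  undup [seq distance (p e.1) (p e.2)
        | e <- enum [pred e : G * G | edge e.1 e.2]].

Definition has_drawing_with_lengths (G : sgraph) (d : nat) : Prop :=
  exists p : G -> 'rV[R]_2, drawing p /\ size (edge_lengths p) = d.

Lemma ex_drawing_with_lengths (G : sgraph) :
  exists d, `[< has_drawing_with_lengths G d >].
Proof.
pose x (v : G) : R := (enum_rank v)%:R.
have xI : injective x.
  by move=> u v /eqP; rewrite eqr_nat => /eqP /ord_inj /enum_rank_inj.
pose p (v : G) : 'rV[R]_2 := \row_(i < 2) x v ^+ i.+1.
exists (size (edge_lengths p)); apply/asboolP; exists p; split=> //; split.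
  by move=> u v /rowP /(_ 0); rewrite !mxE !expr1 => /xI.
move=> u v w uv [t [/andP[t0 t1] /rowP e]].
have := e 0; rewrite !mxE !expr1 => e0.
have := e 1; rewrite !mxE /= e0 => e1.
have /eqP : t * (1 - t) * (x u - x v) ^+ 2 = 0.
  transitivity ((1 - t) * x u ^+ 2 + t * x v ^+ 2
                 - ((1 - t) * x u + t * x v) ^+ 2); first by ring.
  by rewrite e1 subrr.
rewrite mulf_eq0 sqrf_eq0 mulf_eq0 (gt_eqF t0) subr_eq0 (gt_eqF t1) /= subr_eq0.
by move=> /eqP /xI uE; rewrite uE edge_irrefl in uv.
Qed.

Definition distance_number (G : sgraph) : nat :=
  ex_minn (ex_drawing_with_lengths G).

End Drawings.

(* Main.v *)
(** By the Ding-Oporowski argument, [G] has a tree-partition of width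
    [w = O(k Delta)]: a set [S] that is to lie in the root bag is either small,
    and then becomes the root bag above a tree-partition of the rest rooted at
    its neighbours, or is split by a balanced separator.  A node of the
    partition tree has at most [w Delta] children joined to its bag by an edge.
    By the heavy-path decomposition every vertex lies below [O(log n)] light
    steps.  Give each pair (light level, child number) and each position in a
    bag an independent formal vector, and place a vertex at the sum of the
    vectors met on its way down from the root.  Distinct vertices get distinct
    sums, edges realise only [O(log n * w Delta * w^2)] difference vectors, and
    a generic linear projection to the plane gives the drawing. *)

Require Import Defs.
From HB Require Import structures.
From mathcomp Require Import all_boot all_order all_algebra.
From mathcomp Require Import boolp reals exp.
From mathcomp Require Import zify ring lra.

Set Implicit Arguments.
Unset Strict Implicit.
Unset Printing Implicit Defensive.

Import Order.TTheory GRing.Theory Num.Theory.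
Local Open Scope nat_scope.

(** * Balanced separators from tree decompositions *)

Definition within (G : sgraph) (W : {set G}) : rel G :=
  [rel u v | [&& u \in W, v \in W & edge u v]].

Lemma within_connect_sym (G : sgraph) (W : {set G}) : connect_sym (within W).
Proof.
apply: sym_connect_sym => x y; rewrite /within /=.
by rewrite edge_sym; case: (x \in W); case: (y \in W).
Qed.

(** A simple path inside [W] between two different neighbours of [t] would close up through [t] to a
    cycle. *)
Lemma acyclic_unique_neighbor (T : sgraph) (W : {set T}) (t x y : T) :
  acyclic T -> t \notin W -> x \in W -> connect (within W) x y ->
  edge t x -> edge t y -> x = y.
Proof.
move=> acT tW xW /connectP[p0 p0P ->].
case/shortenP: p0P => p pP pU _ tx ty; apply/eqP; apply: contraT => xy.
case: p pP pU ty xy => [|z p] pP pU ty xy; first by rewrite eqxx in xy.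
have pW : {subset x :: z :: p <= W}.
  elim: (z :: p) x {pU ty xy tx} xW pP => [|b q IH] a aW /=.
    by move=> _ v; rewrite inE => /eqP->.
  move=> /andP[/and3P[_ bW _] /(IH _ bW) qW] v; rewrite inE.
  by move=> /orP[/eqP->//|/qW].
have pE : path edge x (z :: p).
  by apply: sub_path pP => a b /and3P[].
exfalso; apply: (acT [:: t, x, z & p]) => //.
apply/andP; split; last first.
  by rewrite cons_uniq pU andbT; apply: contra tW => /pW.
by rewrite /cycle rcons_path /= tx /=; move: pE => /= ->; rewrite edge_sym.
Qed.

Section Separator.
Variables (G T : sgraph) (bag : T -> {set G}) (k : nat).
Hypothesis decT : tree_decomposition bag.
Hypothesis bag_le : forall t, #|bag t| <= k.
Variable S : {set G}.

(** [attached t W] makes [W] a union of components of [T] minus [t]; [part t W] is then what [bag t]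
    cuts off from [S] on the side of [W]. *)
Let attached (t : T) (W : {set T}) :=
  t \notin W /\ forall x y, x \in W -> y \notin W -> edge x y -> y = t.
Let part (t : T) (W : {set T}) := S :&: ((\bigcup_(s in W) bag s) :\: bag t).

Let part_split (t : T) (W W1 W2 : {set T}) :
  W \subset W1 :|: W2 -> #|part t W| <= #|part t W1| + #|part t W2|.
Proof.
move=> W12; apply: leq_trans (leq_card_setU _ _); apply: subset_leq_card.
apply/subsetP => v; rewrite !inE => /andP[-> /andP[-> /bigcupP[s sW vs]]] /=.
move/subsetP/(_ _ sW): W12; rewrite inE => /orP[] sW'; apply/orP; [left|right].
  by apply/bigcupP; exists s.
by apply/bigcupP; exists s.
Qed.

Let part_step (t c : T) (W : {set T}) :
  #|part t W| <= #|part c (W :\ c)| + k.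
Proof.
apply: leq_trans (leq_add (leqnn _) (bag_le c)).
apply: leq_trans (leq_card_setU _ _); apply: subset_leq_card.
apply/subsetP => v; rewrite !inE => /andP[-> /andP[_ /bigcupP[s sW vs]]] /=.
case: (boolP (v \in bag c)) => vc; first by rewrite orbT.
rewrite orbF; apply/bigcupP; exists s => //; rewrite !inE sW andbT.
by apply: contra vc => /eqP<-.
Qed.

(** Descend in the tree while the part is too large. A disconnected [W] is replaced by one component
    or by the rest, whichever still carries [th] vertices. If [W] is connected, [t] moves to its
    neighbour in [W], which loses at most [k] vertices. Either way [W] shrinks. *)
Let attached_small th (t : T) (W : {set T}) :
  attached t W -> th <= #|part t W| ->
  exists t' W', [/\ attached t' W', th <= #|part t' W'|
                  & #|part t' W'| <= th.*2 + k].
Proof.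
have acT : acyclic T by case: decT => -[].
move: {2}(#|W|).+1 (ltnSn #|W|) => n; elim: n t W => // n IH t W Wn [tW attW] thW.
have [small|big] := leqP #|part t W| (th.*2 + k); first by exists t, W.
have /set0Pn[x xW] : W != set0.
  apply: contraTneq big => ->; rewrite /part big_set0 set0D setI0 cards0.
  by rewrite ltn0.
pose W1 := [set y in W | connect (within W) x y].
have xW1 : x \in W1 by rewrite inE xW connect0.
have [/eqP W2_0|W2_n0] := boolP (W :\: W1 == set0).
  have Wconn y : y \in W -> connect (within W) x y.
    move=> yW; have : y \notin W :\: W1 by rewrite W2_0 inE.
    by rewrite !inE yW andbT negbK.
  (* [c] is the neighbour of [t] in [W] if there is one, and arbitrary otherwise. By uniqueness of
     this neighbour no edge joins [t] to [W :\ c], so [W :\ c] is attached to [c]. *)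
  have [c [cW cP]] : exists c, c \in W /\
      forall z, z \in W -> edge z t -> edge c t.
    have [/exists_inP[c cW ct]|no] := boolP [exists c in W, edge c t].
      by exists c; split.
    exists x; split=> // z zW zt; case/negP: no.
    by apply/exists_inP; exists z.
  have cW' : #|W :\ c| < n.
    by have := cardsD1 c W; rewrite cW; lia.
  apply: (IH c (W :\ c)) => //; last by have := part_step t c W; lia.
  split; first by rewrite !inE eqxx.
  move=> z y; rewrite !inE => /andP[zc zW]; rewrite negb_and negbK.
  case/orP=> [/eqP//|yW zy].
  have yt := attW _ _ zW yW zy; rewrite yt in zy.
  case/negP: zc; apply/eqP; apply: (acyclic_unique_neighbor acT tW zW).
  - apply: connect_trans (Wconn _ cW).
    by rewrite within_connect_sym; exact: Wconn.
  - by rewrite edge_sym.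
  - by rewrite edge_sym; exact: (cP z).
have W1W : W1 \subset W by apply/subsetP => y; rewrite inE => /andP[].
have [y] := set0Pn _ W2_n0; rewrite inE => /andP[yW1 yW].
have W12 : #|part t W| <= #|part t W1| + #|part t (W :\: W1)|.
  by apply: part_split; apply/subsetP => z zW; rewrite in_setU in_setD zW andbT orbN.
(* Both pieces together carry more than [th.*2 + k], so one of them carries at least [th]. *)
have [th1|th1] := leqP th #|part t W1|.
  apply: (IH t W1) => //.
    apply: leq_trans (_ : #|W| <= n) => //; apply: proper_card.
    by apply/properP; split=> //; exists y.
  split; first by apply: contra tW => /(subsetP W1W).
  move=> a b; rewrite !inE => /andP[aW xa]; rewrite negb_and.
  have [bW /= xb ab|bW _ ab] := boolP (b \in W); last exact: (attW a b).
  case/negP: xb; apply: connect_trans xa (connect1 _).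
  by rewrite /within /= aW bW.
apply: (IH t (W :\: W1)) => //; last by lia.
  apply: leq_trans (_ : #|W| <= n) => //; apply: proper_card.
  apply/properP; split; first exact: subsetDl.
  by exists x => //; rewrite !inE xW connect0.
split; first by rewrite inE negb_and tW orbT.
move=> a b; rewrite !inE => /andP[xa aW]; rewrite aW /= in xa.
rewrite negb_and negbK.
have [bW /=|bW _ ab] := boolP (b \in W); last exact: (attW a b).
rewrite orbF => xb ab; case/negP: xa; apply: connect_trans xb (connect1 _).
by rewrite /within /= aW bW edge_sym.
Qed.

(** The separator is a single bag [bag t]: [A] collects the bags of [t] and of [W], and [B] the bags
    outside [W]. Every edge lies in some bag, hence within one side. *)
Lemma separation th : th + k <= #|S| ->
  exists A B : {set G},
    [/\ A :|: B = setT, #|A :&: B| <= k,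
        forall u v, u \in A :\: B -> v \in B :\: A -> ~~ edge u v
      & th <= #|S :&: (A :\: B)| <= th.*2 + k].
Proof.
case: decT => -[[T0 _] _] edgeT conT.
have /card_gt0P[t0 _] := T0.
move=> thS.
(* The descent starts from all nodes but an arbitrary [t0], whose bag takes away at most [k]
   vertices of [S]. *)
have [t [W [[tW attW] th1 th2]]] :
  exists t W, [/\ attached t W, th <= #|part t W| & #|part t W| <= th.*2 + k].
  apply: (@attached_small th t0 (~: [set t0])).
    by split=> [|x y]; rewrite !inE ?negbK ?eqxx // => _ /eqP.
  have : S :\: bag t0 \subset part t0 (~: [set t0]).
    apply/subsetP => v; rewrite !inE => /andP[vt0 ->]; rewrite vt0 /=.
    case: (conT v) => /set0Pn[s]; rewrite inE => vs _.
    by apply/bigcupP; exists s => //; rewrite !inE; apply: contra vt0 => /eqP<-.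
  move/subset_leq_card; apply: leq_trans.
  have := cardsID (bag t0) S; have := subset_leq_card (subsetIr S (bag t0)).
  by have := bag_le t0; lia.
pose A := \bigcup_(s in t |: W) bag s; pose B := \bigcup_(s in ~: W) bag s.
(* The nodes whose bags contain a vertex outside [bag t] are connected and avoid [t], the only exit
   from [W]; so they lie all inside or all outside [W]. *)
have ABt : A :&: B \subset bag t.
  apply/subsetP => v; rewrite inE => /andP[/bigcupP[s sW vs] /bigcupP[r rW vr]].
  move: sW rW; rewrite !inE => /orP[/eqP<-//|sW rW].
  apply: contraT => vt; case: (conT v) => _ /(_ s r); rewrite !inE => /(_ vs vr).
  set e := (X in connect X) => sr.
  have clW : closed e W.
    move=> a b /=; rewrite /e /= !inE => /and3P[va vb ab].
    apply/idP/idP => [aW|bW]; apply: contraT => nW.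
      by case/negP: vt; rewrite -(attW _ _ aW nW ab).
    by case/negP: vt; rewrite edge_sym in ab; rewrite -(attW _ _ bW nW ab).
  by rewrite -(closed_connect clW sr) sW in rW.
have ABE : A :\: B = (\bigcup_(s in W) bag s) :\: bag t.
  apply/setP => v; rewrite !inE; apply/andP/andP => -[vB vA]; split.
  - by apply: contra vB => vt; apply/bigcupP; exists t => //; rewrite inE.
  - case/bigcupP: vA => s; rewrite !inE => /orP[/eqP->|sW] vs.
      by case/negP: vB; apply/bigcupP; exists t => //; rewrite inE.
    by apply/bigcupP; exists s.
  - apply: contra vB => vB; apply: (subsetP ABt); rewrite inE vB andbT.
    by case/bigcupP: vA => s sW vs; apply/bigcupP; exists s => //; rewrite inE sW orbT.
  - by case/bigcupP: vA => s sW vs; apply/bigcupP; exists s => //; rewrite inE sW orbT.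
exists A, B; split.
- apply/setP => v; rewrite !inE; apply/orP.
  case: (conT v) => /set0Pn[s]; rewrite inE => vs _.
  have [sW|sW] := boolP (s \in W).
    by left; apply/bigcupP; exists s => //; rewrite inE sW orbT.
  by right; apply/bigcupP; exists s => //; rewrite inE.
- exact: leq_trans (subset_leq_card ABt) (bag_le t).
- move=> u v; rewrite !inE => /andP[uB _] /andP[vA _].
  apply/negP => /edgeT[s [us vs]].
  have [sW|sW] := boolP (s \in W).
    by case/negP: vA; apply/bigcupP; exists s => //; rewrite inE sW orbT.
  by case/negP: uB; apply/bigcupP; exists s => //; rewrite inE.
- by rewrite ABE th1 th2.
Qed.

End Separator.

(** * Tree-partitions *)

Definition no_edge (G : sgraph) (A B : {set G}) : Prop :=
  forall u v, u \in A -> v \in B -> ~~ edge u v.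

(* A rooted tree-partition of the vertex set [U] with root bag [R]: a member
   [c] of [cs] stands for the subtree at a child of the root, with root bag
   [c.1] and vertex set [c.2]. *)
Inductive tree_partition (G : sgraph) (w : nat) : {set G} -> {set G} -> Prop :=
  TreePartition (R U : {set G}) (cs : {set {set G} * {set G}}) of
    #|R| <= w
  & U = R :|: \bigcup_(c in cs) c.2
  & (forall c, c \in cs -> tree_partition w c.1 c.2)
  & (forall c, c \in cs -> [disjoint R & c.2])
  & (forall c, c \in cs -> no_edge R (c.2 :\: c.1))
  & (forall c d, c \in cs -> d \in cs -> c != d ->
       [disjoint c.2 & d.2] /\ no_edge c.2 d.2)
  : tree_partition w R U.

Lemma no_edge_sym (G : sgraph) (A B : {set G}) : no_edge A B -> no_edge B A.
Proof. by move=> AB u v uB vA; rewrite edge_sym; exact: AB. Qed.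

Lemma no_edgeS (G : sgraph) (A B A' B' : {set G}) :
  A' \subset A -> B' \subset B -> no_edge A B -> no_edge A' B'.
Proof.
by move=> /subsetP A'A /subsetP B'B AB u v /A'A uA /B'B vB; exact: AB.
Qed.

Lemma tree_partition1 (G : sgraph) (w : nat) (U : {set G}) :
  #|U| <= w -> tree_partition w U U.
Proof.
move=> Uw; exists set0 => //; try by move=> c; rewrite inE.
by rewrite big_set0 setU0.
Qed.

Lemma tree_partition_add (G : sgraph) (w : nat) (R R' U' : {set G}) :
  #|R| <= w -> tree_partition w R' U' -> [disjoint R & U'] ->
  no_edge R (U' :\: R') -> tree_partition w R (R :|: U').
Proof.
move=> Rw tp dis ne; exists [set (R', U')] => //.
- by rewrite big_set1.
- by move=> c /set1P->.
- by move=> c /set1P->.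
- by move=> c /set1P->.
- by move=> c d /set1P-> /set1P->; rewrite eqxx.
Qed.

(** The two partitions overlap only in their root bags, so the subtrees below one root avoid the
    other side altogether. Uniting the root bags and keeping all children therefore creates no
    conflict. *)
Lemma tree_partition_merge (G : sgraph) (w : nat) (R1 U1 R2 U2 : {set G}) :
  tree_partition w R1 U1 -> tree_partition w R2 U2 ->
  U1 :&: U2 \subset R1 :&: R2 -> no_edge (U1 :\: U2) (U2 :\: U1) ->
  #|R1 :|: R2| <= w -> tree_partition w (R1 :|: R2) (U1 :|: U2).
Proof.
move=> tp1 tp2 Usub ne Rw.
have child_sub w' (R U : {set G}) : tree_partition w' R U -> R \subset U.
  by case=> {}R {}U cs _ -> *; exact: subsetUl.
have R1U1 := child_sub _ _ _ tp1; have R2U2 := child_sub _ _ _ tp2.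
case: tp1 Usub ne Rw R1U1 R2U2 => {}R1 {}U1 cs1 _ U1E tp1 dis1 ne1 cc1.
case: tp2 => {}R2 {}U2 cs2 _ U2E tp2 dis2 ne2 cc2 Usub ne Rw R1U1 R2U2.
have c1U c : c \in cs1 -> c.2 \subset U1 :\: U2.
  move=> c1; have cU1 : c.2 \subset U1.
    rewrite U1E; apply: subset_trans (subsetUr _ _).
    exact: (bigcup_sup c).
  rewrite subsetD cU1 /=; apply/pred0Pn => -[v /= /andP[vc vU2]].
  have vI : v \in U1 :&: U2 by rewrite inE (subsetP cU1).
  move: (subsetP Usub _ vI); rewrite inE => /andP[vR1 _].
  by rewrite (disjointFr (dis1 _ c1)) in vc.
have c2U c : c \in cs2 -> c.2 \subset U2 :\: U1.
  move=> c2; have cU2 : c.2 \subset U2.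
    rewrite U2E; apply: subset_trans (subsetUr _ _).
    exact: (bigcup_sup c).
  rewrite subsetD cU2 /=; apply/pred0Pn => -[v /= /andP[vc vU1]].
  have vI : v \in U1 :&: U2 by rewrite inE vU1 (subsetP cU2).
  move: (subsetP Usub _ vI); rewrite inE => /andP[_ vR2].
  by rewrite (disjointFr (dis2 _ c2)) in vc.
have dis12 : [disjoint U1 :\: U2 & U2 :\: U1].
  by apply/pred0P => v /=; rewrite !inE; case: (v \in U1); rewrite ?andbF.
exists (cs1 :|: cs2) => //.
- by rewrite bigcup_setU U1E U2E setUACA.
- by move=> c; rewrite inE => /orP[]; [exact: tp1|exact: tp2].
- move=> c; rewrite inE disjoints_subset subUset -!disjoints_subset => /orP[] cc.
    rewrite dis1 //=; apply: disjointWr (c1U _ cc) _; apply: disjointWl R2U2 _.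
    by rewrite disjoint_sym disjoints_subset setDE subsetIr.
  rewrite dis2 // andbT; apply: disjointWr (c2U _ cc) _; apply: disjointWl R1U1 _.
  by rewrite disjoint_sym disjoints_subset setDE subsetIr.
- move=> c; rewrite inE => /orP[] cc u v uR vc.
    have [uU1|uU1] := boolP (u \in U1).
      apply: (ne1 _ cc) => //; move: uR; rewrite inE => /orP[//|uR2].
      suff : u \in R1 :&: R2 by rewrite inE => /andP[].
      by apply: (subsetP Usub); rewrite inE uU1 (subsetP R2U2).
    apply: (no_edge_sym ne).
      move: uR; rewrite !inE uU1 => /orP[uR1|uR2]; last exact: (subsetP R2U2).
      by case/negP: uU1; exact: (subsetP R1U1).
    by apply: (subsetP (c1U _ cc)); move: vc; rewrite inE => /andP[].
  have [uU2|uU2] := boolP (u \in U2).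
    apply: (ne2 _ cc) => //; move: uR; rewrite inE => /orP[uR1|//].
    suff : u \in R1 :&: R2 by rewrite inE => /andP[].
    by apply: (subsetP Usub); rewrite inE uU2 andbT (subsetP R1U1).
  apply: ne.
    move: uR; rewrite !inE uU2 => /orP[uR1|uR2]; first exact: (subsetP R1U1).
    by case/negP: uU2; exact: (subsetP R2U2).
  by apply: (subsetP (c2U _ cc)); move: vc; rewrite inE => /andP[].
- move=> c d; rewrite !inE => /orP[] cc /orP[] dd cd.
  + exact: cc1.
  + split; first exact: disjointW (c1U _ cc) (c2U _ dd) dis12.
    exact: no_edgeS (c1U _ cc) (c2U _ dd) ne.
  + rewrite disjoint_sym; split; first exact: disjointW (c1U _ dd) (c2U _ cc) dis12.
    by apply: no_edge_sym; exact: no_edgeS (c1U _ dd) (c2U _ cc) ne.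
  + exact: cc2.
Qed.

Lemma subset_intermediate (T : finType) (A B : {set T}) (m : nat) :
  A \subset B -> #|A| <= m <= #|B| ->
  exists C : {set T}, [/\ A \subset C, C \subset B & #|C| = m].
Proof.
move=> AB; move mA: (m - #|A|) => d; elim: d A AB mA => [|d IH] A AB mA Am.
  by exists A; split=> //; lia.
have /subsetPn[x xB xA] : ~~ (B \subset A).
  by apply: contraTN isT => /subset_leq_card; lia.
have cA : #|x |: A| = #|A|.+1 by rewrite cardsU1 xA.
have [||| C [AC CB mC]] := IH (x |: A).
- by rewrite subUset sub1set xB.
- by lia.
- by lia.
by exists C; split=> //; apply: subset_trans AC; exact: subsetUr.
Qed.

Lemma card_neighbors (G : sgraph) (S : {set G}) :
  #|\bigcup_(u in S) [set v | edge u v]| <= #|S| * max_degree G.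
Proof.
rewrite -sum_nat_const; apply: (@leq_trans (\sum_(u in S) #|[set v | edge u v]|)).
  apply: (big_ind2 (fun (A : {set G}) m => #|A| <= m)); first by rewrite cards0.
    by move=> A a B b Aa Bb; apply: leq_trans (leq_card_setU _ _) (leq_add Aa Bb).
  by [].
by apply: leq_sum => u _; exact: (leq_bigmax u).
Qed.

(* The bound [2 * #|S| - 4 * k] on the root bag survives a splitting of [S],
   because the two parts have total size at most [#|S| + 2 * k]. *)
Lemma tree_partition_bounded (G : sgraph) (k D : nat) :
  0 < D -> max_degree G <= D -> 0 < k ->
  (exists (T : sgraph) (bag : T -> {set G}),
     tree_decomposition bag /\ forall t, #|bag t| <= k) ->
  forall U S : {set G}, S \subset U -> 4 * k <= #|S| <= 13 * k * D ->
  exists R : {set G}, [/\ S \subset R, tree_partition (26 * k * D) R U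
                        & #|R| + 4 * k <= 2 * #|S|].
Proof.
move=> D0 GD k0 [T [bag [decT bagk]]] U.
(* The outer induction on [#|U|] serves the case where [S] is removed from [U]. The inner one on
   [#|S|] serves the splitting of [S], under which [U] need not shrink. *)
move: {2}(#|U|).+1 (ltnSn #|U|) => n; elim: n U => // n IHU U Un S.
move: {2}(#|S|).+1 (ltnSn #|S|) => m; elim: m S U Un => // m IHS S U Un Sm SU kS.
have kD : k <= k * D by rewrite leq_pmulr.
have [Ssmall|Sbig] := leqP #|S| (13 * k).
  exists S; split=> //; last by lia.
  pose N := (\bigcup_(u in S) [set v | edge u v]) :&: (U :\: S).
  have NM : #|N| <= 13 * k * D.
    apply: leq_trans (subset_leq_card (subsetIl _ _)) _.
    by apply: leq_trans (card_neighbors _) (leq_mul _ _).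
  have neN (R : {set G}) : N \subset R -> no_edge S ((U :\: S) :\: R).
    move=> NR u v uS /setDP[vU vR]; apply: contra vR => uv.
    apply: (subsetP NR); rewrite inE vU andbT; apply/bigcupP; exists u => //.
    by rewrite inE.
  have dS : [disjoint S & U :\: S] by rewrite disjoint_sym disjoints_subset setDE subsetIr.
  rewrite -[U in tree_partition _ _ U](setID U S) (setIidPr SU).
  have [Usmall|Ubig] := leqP #|U :\: S| (13 * k * D).
    apply: (@tree_partition_add _ _ _ (U :\: S)) => //; first by lia.
      by apply: tree_partition1; lia.
    by apply: neN; exact: subsetIr.
  (* The neighbourhood [N] may have fewer than [4 * k] vertices, so it is padded to the largest size
     allowed. *)
  have [|C [NC CU cC]] := @subset_intermediate _ N (U :\: S) (13 * k * D) (subsetIr _ _).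
    by rewrite NM ltnW.
  have [||R [CR tp cR]] := IHU (U :\: S) _ C CU.
  - by have := cardsD U S; rewrite (setIidPr SU); have := subset_leq_card SU; lia.
  - by lia.
  apply: (@tree_partition_add _ _ _ R) => //; first by lia.
  by apply: neN; exact: subset_trans NC CR.
(* With threshold [4 * k], between [4 * k] and [9 * k] vertices of [S] lie off [B]. Since
   [#|S| > 13 * k], more than [4 * k] remain in [B], and both new sets are smaller than [S] even
   after adding the at most [k] vertices of [X]. *)
have [|A [B [AB cAB neAB /andP[th1 th2]]]] := @separation G T bag k decT bagk S (4 * k).
  by lia.
pose X := A :&: B :&: U.
have cX : #|X| <= k by apply: leq_trans cAB; apply: subset_leq_card (subsetIl _ _).
have cSB := cardsID B S.
have cSAB : S :&: (A :\: B) = S :\: B.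
  apply/setP => v; rewrite !inE; have : v \in A :|: B by rewrite AB inE.
  by rewrite inE; case: (v \in B); rewrite /= ?andbF ?orbF // => ->; rewrite andbT.
rewrite cSAB in th1 th2.
(* [X] goes into both sets, so that the overlap of the two sides lies in both root bags, as merging
   requires. *)
pose S1 := (S :\: B) :|: X; pose S2 := (S :&: B) :|: X.
have c1 : #|S1| <= #|S :\: B| + k.
  by apply: leq_trans (leq_card_setU _ _) _; rewrite leq_add2l.
have c2 : #|S2| <= #|S :&: B| + k.
  by apply: leq_trans (leq_card_setU _ _) _; rewrite leq_add2l.
have c1' : #|S :\: B| <= #|S1| by apply: subset_leq_card (subsetUl _ _).
have c2' : #|S :&: B| <= #|S2| by apply: subset_leq_card (subsetUl _ _).
have [||||R1 [S1R1 tp1 cR1]] := IHS S1 (A :&: U).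
- by apply: leq_ltn_trans Un; apply: subset_leq_card (subsetIr _ _).
- by lia.
- apply/subsetP => v; rewrite !inE -!andbA => /orP[/andP[vB vS]|/and3P[-> _ ->]//].
  rewrite (subsetP SU) // andbT; have : v \in A :|: B by rewrite AB inE.
  by rewrite inE (negPf vB) orbF.
- by lia.
have [||||R2 [S2R2 tp2 cR2]] := IHS S2 (B :&: U).
- by apply: leq_ltn_trans Un; apply: subset_leq_card (subsetIr _ _).
- by lia.
- apply/subsetP => v; rewrite !inE -!andbA => /orP[/andP[vS ->]|/and3P[_ -> ->]//].
  by rewrite (subsetP SU).
- by lia.
have cR : #|R1 :|: R2| + 4 * k <= 2 * #|S|.
  have cR12 : #|R1 :|: R2| <= #|R1| + #|R2| by rewrite leq_card_setU.
  by lia.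
exists (R1 :|: R2); split=> //.
- apply/subsetP => v vS; rewrite inE; case: (boolP (v \in B)) => vB.
    by apply/orP; right; apply: (subsetP S2R2); rewrite !inE vS vB.
  by apply/orP; left; apply: (subsetP S1R1); rewrite !inE vS vB.
- have -> : U = (A :&: U) :|: (B :&: U) by rewrite -setIUl AB setTI.
  apply: tree_partition_merge => //; last by lia.
    apply/subsetP => v; rewrite !inE => /andP[/andP[vA vU] /andP[vB _]].
    have vX : v \in X by rewrite !inE vA vB.
    by rewrite (subsetP S1R1) ?(subsetP S2R2) // inE vX orbT.
  apply: no_edgeS neAB.
    by apply/subsetP => v; rewrite !inE; case: (v \in U); rewrite ?andbF ?andbT.
  by apply/subsetP => v; rewrite !inE; case: (v \in U); rewrite ?andbF ?andbT.
Qed.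

Lemma exists_tree_partition (G : sgraph) (k : nat) :
  0 < max_degree G -> has_decomposition_of_width G k ->
  exists R : {set G}, tree_partition (26 * k.+1 * max_degree G) R setT.
Proof.
move=> D0 [T [bag [decT widthE]]].
have kD : k.+1 <= k.+1 * max_degree G by rewrite leq_pmulr.
have [Gsmall|Gbig] := leqP #|[set: G]| (4 * k.+1).
  by exists setT; apply: tree_partition1; lia.
(* Any set of this size can be prescribed for the root bag; the number of vertices in a bag is at
   most [k.+1]. *)
have [|C [_ CG cC]] := @subset_intermediate _ set0 [set: G] (4 * k.+1) (sub0set _).
  by rewrite cards0 (ltnW Gbig).
have [|||R [_ tp _]] := @tree_partition_bounded G k.+1 _ D0 (leqnn _) _ _ setT C CG.
- by [].
- exists T, bag; split=> // t; rewrite -widthE; apply: leq_trans (leqSpred _).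
  exact: (leq_bigmax t).
- by lia.
by exists R.
Qed.

(** * Heavy-path coding *)

(** This numbers the children of a node. Only those in [E], joined to the parent bag by an edge,
    affect edge differences and need small numbers; the others are numbered from [m] on. *)
Lemma bounded_labelling (T : finType) (A E : {set T}) (m : nat) :
  E \subset A -> #|E| <= m ->
  exists lab : T -> nat, {in A &, injective lab} /\ {in E, forall c, lab c < m}.
Proof.
move=> EA Em.
exists (fun c => if c \in E then index c (enum E) else m + index c (enum A)).
have iE c : c \in E -> index c (enum E) < m.
  by move=> cE; apply: leq_trans Em; rewrite cardE index_mem mem_enum.
split=> [c d cA dA|c cE]; last by rewrite cE iE.
case: ifP => cE; case: ifP => dE.
- by apply: (index_inj c); rewrite mem_enum.
- by have := iE _ cE; lia.
- by have := iE _ dE; lia.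
- by move/addnI; apply: (index_inj c); rewrite mem_enum.
Qed.

(** Picking in each such child a neighbour of [R] is injective, because the children are
    disjoint. *)
Lemma card_children_le (G : sgraph) (R : {set G}) (cs : {set {set G} * {set G}}) :
  (forall c d, c \in cs -> d \in cs -> c != d -> [disjoint c.2 & d.2]) ->
  #|[set c in cs | [exists u in R, exists v in c.2, edge u v]]|
    <= #|R| * max_degree G.
Proof.
move=> dis; apply: leq_trans (card_neighbors R).
set E := [set c in cs | _]; set N := \bigcup_(u in R) _.
pose phi (c : {set G} * {set G}) := [pick v in c.2 :&: N].
have phiP c : c \in E -> exists v, [/\ phi c = Some v, v \in c.2 & v \in N].
  rewrite inE => /andP[_ /exists_inP[u uR /exists_inP[v vc uv]]].
  rewrite /phi; case: pickP => [x|/(_ v)].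
    by rewrite inE => /andP[xc xN]; exists x.
  rewrite inE vc /= => /bigcupP[]; exists u => //; by rewrite inE.
rewrite -(card_in_imset (f := phi)); last first.
  move=> c d cE dE cd; apply/eqP; apply: contraT => ncd.
  have [v [cv vc _]] := phiP c cE; have [x [dx xd _]] := phiP d dE.
  have vx : v = x by move: cd; rewrite cv dx => -[].
  move: cE dE; rewrite !inE => /andP[cC _] /andP[dC _].
  by have := disjointFr (dis _ _ cC dC ncd) vc; rewrite vx xd.
rewrite -(card_imset N (@Some_inj _)); apply: subset_leq_card.
apply/subsetP => _ /imsetP[c cE ->]; have [v [-> _ vN]] := phiP c cE.
exact: imset_f.
Qed.

(** Take [h] largest: any other child is disjoint from it and no larger, so it fills at most half of
    [U]. Without children [h] is a dummy. *)
Lemma exists_heavy_child (G : sgraph) (U : {set G})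
    (cs : {set {set G} * {set G}}) :
  (forall c, c \in cs -> c.2 \subset U) ->
  (forall c d, c \in cs -> d \in cs -> c != d -> [disjoint c.2 & d.2]) ->
  exists h, forall c, c \in cs -> c != h -> (#|c.2|.*2 <= #|U|).
Proof.
move=> csU dis; have [->|[c0 c0cs]] := set_0Vmem cs.
  by exists (set0, set0) => c; rewrite inE.
case: (arg_maxnP (fun c : {set G} * {set G} => #|c.2|) c0cs) => h hcs hmax.
exists h => c ccs ch; rewrite -addnn.
apply: leq_trans (leq_add (leqnn _) (hmax _ ccs)) _.
have /eqP <- : #|c.2 :|: h.2| == #|c.2| + #|h.2|.
  by rewrite (leq_card_setU c.2 h.2); exact: dis.
by apply: subset_leq_card; rewrite subUset !csU.
Qed.

Local Open Scope ring_scope.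

(* [inl i] is the offset of the [i]-th vertex of a bag, [inr (l, 0)] the step
   to the heavy child at level [l], and [inr (l, c.+1)] the step to a light
   child. *)
Definition var_index (x : nat + nat * nat) : nat := pickle x.

Section Coding.
Variable R : realType.

(** The independent formal vectors are distinct powers of one indeterminate: coordinates are
    coefficients, and evaluation at a point is a linear functional. *)
Definition monomial (x : nat + nat * nat) : {poly R} := 'X^(var_index x).

Lemma coef_monomial x y : (monomial x)`_(var_index y) = (x == y)%:R.
Proof.
by rewrite coefXn (inj_eq (pcan_inj (@pickleK _))) eq_sym.
Qed.

Definition steps (L m : nat) : seq {poly R} :=
  [seq monomial (inr (a, b)) | a <- iota 0 L.+1, b <- iota 0 m.+1].

(** The summand [e] is [0] for an edge inside a bag and plus or minus a step for an edge between a
    bag and a child bag; [d] compares the positions in the bags. *)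
Definition differences (w L m : nat) : seq {poly R} :=
  [seq e + d | e <- 0 :: steps L m ++ [seq - x | x <- steps L m],
               d <- [seq monomial (inl i) - monomial (inl j)
                    | i <- iota 0 w, j <- iota 0 w]].

Lemma size_differences w L m :
  size (differences w L m) = ((L.+1 * m.+1).*2.+1 * (w * w))%N.
Proof.
have sz : size (steps L m) = (L.+1 * m.+1)%N by rewrite size_allpairs !size_iota.
rewrite size_allpairs -cat1s size_cat (size_cat (steps L m)) sz (size_map _ (steps L m)).
rewrite sz addnn; congr (_ * _)%N.
by rewrite size_allpairs !size_iota.
Qed.

Lemma differencesP w L m i j e : (i < w)%N -> (j < w)%N ->
  e = 0 \/ (exists a b, [/\ (a <= L)%N, (b <= m)%N
            & e = monomial (inr (a, b)) \/ e = - monomial (inr (a, b))]) ->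
  e + (monomial (inl i) - monomial (inl j)) \in differences w L m.
Proof.
move=> iw jw eP; apply: allpairs_f; last first.
  by apply: allpairs_f; rewrite mem_iota.
rewrite inE mem_cat; case: eP => [->|[a [b [aL bm eE]]]]; first by rewrite eqxx.
have xs : monomial (inr (a, b)) \in steps L m.
  by apply: (@allpairs_f _ _ _ (fun a b => monomial (inr (a, b)))); rewrite mem_iota.
by case: eE => ->; rewrite ?xs ?map_f ?orbT.
Qed.

(** Steps and offsets use different coordinates. A step contributes a coefficient 1 or -1 that no
    offset can cancel; without a step, two different offsets remain. *)
Lemma differences_coef w L m d :
  d \in differences w L m -> d != 0 ->
  exists x, d`_(var_index x) = 1 \/ d`_(var_index x) = -1.
Proof.
move=> /allpairsPdep[e [_ [eP /allpairsPdep[i [j [_ _ ->]]] ->]]].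
have cij a b : (monomial (inl i) - monomial (inl j))`_(var_index (inr (a, b))) = 0.
  by rewrite coefB !coef_monomial subrr.
move: eP; rewrite in_cons mem_cat.
move=> /or3P[/eqP->|/allpairsPdep[a [b [_ _ ->]]] _|].
- rewrite add0r subr_eq0 => ij; exists (inl i); left.
  rewrite coefB !coef_monomial eqxx [_ == _](_ : _ = false) ?subr0 //.
  by apply: contraNF ij => /eqP->.
- by exists (inr (a, b)); left; rewrite coefD cij coef_monomial eqxx addr0.
- move=> /mapP[_ /allpairsPdep[a [b [_ _ ->]]] ->] _.
  by exists (inr (a, b)); right; rewrite coefD cij coefN coef_monomial eqxx addr0.
Qed.

(** Induction on the partition, with [l] as a budget of light steps. Vanishing of the coordinates
    above level [l] separates a light child from its siblings, and the form of the codes on the root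
    bag yields the differences along edges to the parent bag. *)
Lemma coding (G : sgraph) (w L : nat) (Rt U : {set G}) (l : nat) :
  tree_partition w Rt U -> (l <= L)%N -> (#|U| < 2 ^ l)%N ->
  exists f : G -> {poly R},
    [/\ {in U &, injective f},
        {in U, forall v x, (f v)`_(var_index (x)) \is a Num.nat},
        {in U, forall v a b, (l < a)%N ->
                 (f v)`_(var_index (inr (a, b))) = 0},
        {in Rt, forall v, exists2 i, (i < w)%N & f v = monomial (inl i)}
      & {in U &, forall u v, edge u v ->
                 f u - f v \in differences w L (w * max_degree G)}].
Proof.
move=> tp; elim: tp l => {Rt U} Rt U cs Rw UE _ IH disR neR discs [|l] lL.
  rewrite expn0 ltnS leqn0 cards_eq0 => /eqP U0.
  have Rt0 : Rt = set0.
    by apply/eqP; rewrite -subset0 -U0 UE subsetUl.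
  by exists (fun=> 0); rewrite U0 Rt0; split; move=> u; rewrite inE.
move=> Ul.
have csU c : c \in cs -> c.2 \subset U.
  by move=> cC; rewrite UE; apply: subset_trans (subsetUr _ _); exact: (bigcup_sup c).
have dis c d : c \in cs -> d \in cs -> c != d -> [disjoint c.2 & d.2].
  by move=> cC dC cd; have [] := discs _ _ cC dC cd.
have [h hP] := exists_heavy_child csU dis.
pose E := [set c in cs | [exists u in Rt, exists v in c.2, edge u v]].
have [||lab [labI labE]] := @bounded_labelling _ cs E (w * max_degree G).
- by apply/subsetP => c; rewrite inE => /andP[].
- by apply: leq_trans (card_children_le Rt dis) _; rewrite leq_mul2r Rw orbT.
pose t c := if c == h then 0%N else (lab c).+1.
have tI c d : c \in cs -> d \in cs -> c != d -> t c != t d.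
  rewrite /t => cC dC cd; case: ifPn => [/eqP ch|_]; case: ifPn => [/eqP dh|_] //.
    by rewrite ch dh eqxx in cd.
  by rewrite eqSS; apply: contra_neq cd; exact: labI.
have tE u v c : c \in cs -> u \in Rt -> v \in c.2 -> edge u v ->
    (t c <= w * max_degree G)%N.
  move=> cC uR vc uv; rewrite /t; case: ifP => // _; apply: labE.
  rewrite inE cC; apply/exists_inP; exists u => //.
  by apply/exists_inP; exists v.
pose lev c := if c == h then l.+1 else l.
have /choice[g gP] : forall c, exists f : G -> {poly R}, c \in cs ->
    [/\ {in c.2 &, injective f},
        {in c.2, forall v x, (f v)`_(var_index (x)) \is a Num.nat},
        {in c.2, forall v a b, (lev c < a)%N ->
                 (f v)`_(var_index (inr (a, b))) = 0},
        {in c.1, forall v, exists2 i, (i < w)%N & f v = monomial (inl i)}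
      & {in c.2 &, forall u v, edge u v ->
                 f u - f v \in differences w L (w * max_degree G)}].
  move=> c; have [cC|cC] := boolP (c \in cs); last by exists (fun=> 0).
  have [||f fP] := IH c cC (lev c).
  - by rewrite /lev; case: ifP => // _; exact: ltnW.
  - rewrite /lev; case: ifPn => [_|ch].
      by apply: leq_ltn_trans Ul; apply: subset_leq_card; exact: csU.
    by have := hP c cC ch; move: Ul; rewrite expnS; lia.
  by exists f.
pose off v := monomial (inl (index v (enum Rt))).
pose f v := if v \in Rt then off v else
  if [pick c in cs | v \in c.2] is Some c then monomial (inr (l.+1, t c)) + g c v
  else 0.
have fR v : v \in Rt -> f v = off v by rewrite /f => ->.
have fc c v : c \in cs -> v \in c.2 -> f v = monomial (inr (l.+1, t c)) + g c v.
  move=> cC vc; rewrite /f (disjointFl (disR _ cC) vc).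
  case: pickP => [d /andP[dC vd]|/(_ c)]; last by rewrite cC vc.
  have [->//|cd] := eqVneq c d.
  by have := disjointFr (dis _ _ cC dC cd) vc; rewrite vd.
have Ucase v : v \in U -> v \in Rt \/ exists2 c, c \in cs & v \in c.2.
  rewrite UE inE => /orP[|/bigcupP[c cC vc]]; first by left.
  by right; exists c.
have offw v : v \in Rt -> (index v (enum Rt) < w)%N.
  by move=> vR; apply: leq_trans Rw; rewrite cardE index_mem mem_enum.
have nat_ge0 (x : R) : x \is a Num.nat -> 0 <= x by move/natr_ge0.
have fcge c v : c \in cs -> v \in c.2 ->
    1 <= (f v)`_(var_index (inr (l.+1, t c))).
  move=> cC vc; rewrite (fc _ _ cC vc) coefD coef_monomial eqxx lerDl.
  by apply: nat_ge0; have [_ gN _ _ _] := gP c cC; exact: gN.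
have fRc u v c : u \in Rt -> c \in cs -> v \in c.2 -> f u <> f v.
  move=> uR cC vc uv; have := fcge _ _ cC vc.
  by rewrite -uv fR // coef_monomial ler10.
(* Codes below a light child vanish at level [l.+1] apart from the step into it. If [c] is heavy,
   its own step coordinate, which may be repeated along the heavy path, tells the codes apart;
   otherwise that of [d] does. *)
have flight c d u v : c \in cs -> d \in cs -> c != d -> d != h ->
    u \in c.2 -> v \in d.2 -> f u <> f v.
  move=> cC dC cd dh uc vd uv.
  have [_ _ gd _ _] := gP d dC.
  have gd0 b : (g d v)`_(var_index (inr (l.+1, b))) = 0.
    by apply: gd => //; rewrite /lev (negPf dh).
  have [ch|ch] := eqVneq c h.
    have := fcge _ _ cC uc; rewrite uv (fc _ _ dC vd) coefD gd0 addr0.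
    rewrite coef_monomial [_ == _](_ : _ = false) ?ler10 //.
    by apply: contraNF (tI _ _ cC dC cd) => /eqP[->].
  have [_ _ gc _ _] := gP c cC.
  have := fcge _ _ dC vd; rewrite -uv (fc _ _ cC uc) coefD gc ?addr0 //; last first.
    by rewrite /lev (negPf ch).
  rewrite coef_monomial [_ == _](_ : _ = false) ?ler10 //.
  by apply: contraNF (tI _ _ cC dC cd) => /eqP[->].
have d_0 i j : (i < w)%N -> (j < w)%N ->
    monomial (inl i) - monomial (inl j) \in differences w L (w * max_degree G).
  by move=> iw jw; rewrite -[_ - _]add0r; apply: differencesP => //; left.
exists f; split.
- move=> u v /Ucase[uR|[c cC uc]] /Ucase[vR|[d dC vd]] uv.
  + move: uv; rewrite !fR // => /(congr1 (fun p : {poly R} =>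
        p`_(var_index (inl (index v (enum Rt)))))).
    rewrite /= !coef_monomial eqxx; case: eqP => [[]|_ /eqP]; last first.
      by rewrite eq_sym oner_eq0.
    by move=> uv _; apply: (index_inj u (s := enum Rt)); rewrite ?mem_enum.
  + by case: (fRc _ _ _ uR dC vd uv).
  + by case: (fRc _ _ _ vR cC uc (esym uv)).
  + have [cd|cd] := eqVneq c d.
      rewrite -cd in vd; move: uv; rewrite (fc _ _ cC uc) (fc _ _ cC vd).
      by move/addrI; have [gI _ _ _ _] := gP c cC; exact: gI.
    have [dh|dh] := eqVneq d h.
      case: (flight d c v u) => //; first by rewrite eq_sym.
      by rewrite -dh.
    by case: (flight c d u v).
- move=> v /Ucase[vR|[c cC vc]] x.
    by rewrite fR // coef_monomial natr_nat.
  rewrite (fc _ _ cC vc) coefD coef_monomial rpredD ?natr_nat //.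
  by have [_ gN _ _ _] := gP c cC; exact: gN.
- move=> v /Ucase[vR|[c cC vc]] a b la; first by rewrite fR // coef_monomial.
  rewrite (fc _ _ cC vc) coefD coef_monomial.
  have [_ _ g0 _ _] := gP c cC; rewrite g0 // ?addr0.
    by case: eqP => // -[] la'; rewrite la' ltnn in la.
  by apply: leq_ltn_trans la; rewrite /lev; case: ifP.
- by move=> v vR; exists (index v (enum Rt)); [exact: offw|exact: fR].
(* An edge from the root bag into a child ends in the root bag of that child, where the code is a
   bare offset. *)
- have Rcase u v c : u \in Rt -> c \in cs -> v \in c.2 -> edge u v ->
      exists i j, [/\ (i < w)%N, (j < w)%N, (t c <= w * max_degree G)%N,
        f u = monomial (inl i) & f v = monomial (inr (l.+1, t c)) + monomial (inl j)].
    move=> uR cC vc uv; have vc1 : v \in c.1.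
      by apply: contraLR uv => vc1; apply: (neR _ cC) => //; rewrite inE vc1.
    have [_ _ _ gR _] := gP c cC; have [j jw gv] := gR _ vc1.
    exists (index u (enum Rt)), j; split=> //; first exact: offw.
    + exact: (tE u v).
    + exact: fR.
    + by rewrite (fc _ _ cC vc) gv.
  move=> u v /Ucase[uR|[c cC uc]] /Ucase[vR|[d dC vd]] uv.
  + by rewrite !fR //; apply: d_0; exact: offw.
  + have [i [j [iw jw tw -> ->]]] := Rcase _ _ _ uR dC vd uv.
    rewrite opprD addrCA; apply: differencesP => //; right.
    by exists l.+1, (t d); split=> //; right.
  + rewrite edge_sym in uv.
    have [i [j [iw jw tw -> ->]]] := Rcase _ _ _ vR cC uc uv.
    rewrite -addrA; apply: differencesP => //; right.
    by exists l.+1, (t c); split=> //; left.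
  + have [cd|cd] := eqVneq c d.
      rewrite -cd in vd; rewrite (fc _ _ cC uc) (fc _ _ cC vd).
      rewrite opprD addrACA subrr add0r.
      by have [_ _ _ _ gd] := gP c cC; exact: gd.
    by have [_ /(_ _ _ uc vd)] := discs _ _ cC dC cd; rewrite uv.
Qed.

End Coding.

(** * Projection to the plane *)

(** The product of the list is a nonzero polynomial [p], and [size p] distinct natural numbers
    exceed its possible number of roots. *)
Lemma exists_common_nonroot (R : numDomainType) (s : seq {poly R}) :
  0 \notin s -> exists a : R, {in s, forall p, p.[a] != 0}.
Proof.
move=> s0; pose p := \prod_(q <- s) q.
have p0 : p != 0.
  by rewrite prodf_seq_neq0; apply/allP => q qs; apply: contraNneq s0 => <-.
pose rs : seq R := [seq i%:R | i <- iota 0 (size p)].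
have rsU : uniq rs.
  by rewrite map_inj_uniq ?iota_uniq // => i j /eqP; rewrite eqr_nat => /eqP.
have /allPn[a _ pa] : ~~ all (root p) rs.
  apply/negP => /(max_poly_roots p0) /(_ rsU).
  by rewrite size_map size_iota ltnn.
exists a => q qs; apply: contra pa => /eqP qa.
by rewrite /p (big_rem q) //= rootM; apply/orP; left; apply/eqP.
Qed.

(* Evaluating at two parameters [a] and [b] is a generic linear projection to
   the plane: once [a] is fixed, the first coordinate determines the only
   parameter [t] at which a point can lie on a given segment. *)
Lemma distance_number_le (R : realType) (G : sgraph) (f : G -> {poly R})
    (D : seq {poly R}) :
  injective f ->
  (forall u v w t, edge u v -> 0 < t < 1 -> f w != (1 - t) *: f u + t *: f v) ->
  (forall u v, edge u v -> f u - f v \in D) ->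
  (distance_number R G <= size D)%N.
Proof.
move=> fI fseg fD.
have [|a aP] := @exists_common_nonroot R
    [seq f e.1 - f e.2 | e <- enum [pred e : G * G | e.1 != e.2]].
  apply/mapP => -[[u v]]; rewrite mem_enum inE /= => uv /esym/eqP.
  by rewrite subr_eq0 => /eqP/fI uvE; rewrite uvE eqxx in uv.
have fa u v : u != v -> (f u).[a] != (f v).[a].
  move=> uv; have := aP (f u - f v); rewrite hornerD hornerN subr_eq0; apply.
  by apply/mapP; exists (u, v) => //; rewrite mem_enum.
pose t u v w := ((f w).[a] - (f u).[a]) / ((f v).[a] - (f u).[a]).
pose q u v w := f w - ((1 - t u v w) *: f u + t u v w *: f v).
(* With [a] fixed these are finitely many polynomials, each nonzero because no code lies on the open
   segment between the codes of adjacent vertices. *)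
have [|b bP] := @exists_common_nonroot R
    [seq q e.1.1 e.1.2 e.2 | e <- enum [pred e : G * G * G |
       edge e.1.1 e.1.2 && (0 < t e.1.1 e.1.2 e.2 < 1)]].
  apply/mapP => -[[[u v] w]]; rewrite mem_enum inE /= => /andP[uv t01] /esym/eqP.
  by rewrite subr_eq0; apply/negP; exact: fseg.
pose p v : 'rV[R]_2 := \row_(i < 2) (f v).[if i == 0 then a else b].
have p0 v : p v 0 0 = (f v).[a] by rewrite mxE.
have p1 v : p v 0 1 = (f v).[b] by rewrite mxE.
have dp : drawing p.
  split=> [u v uv|u v w uv [s [s01 ws]]].
    apply/eqP; apply: contraT => /fa; rewrite -!p0 uv; by rewrite eqxx.
  have uvn : u != v by apply: contraTneq uv => ->; rewrite edge_irrefl.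
  have dn : (f v).[a] - (f u).[a] != 0 by rewrite subr_eq0 fa // eq_sym.
  have ws0 : (f w).[a] = (1 - s) * (f u).[a] + s * (f v).[a].
    by rewrite -!p0 ws !mxE.
  have ws1 : (f w).[b] = (1 - s) * (f u).[b] + s * (f v).[b].
    by rewrite -!p1 ws !mxE.
  have ts : t u v w = s by rewrite /t ws0; field.
  have : (q u v w).[b] != 0.
    apply: bP; apply/mapP; exists (u, v, w) => //.
    by rewrite mem_enum inE /= uv ts.
  by rewrite /q ts !hornerE ws1 subrr eqxx.
(* Evaluation is linear, so the length of an edge depends only on the difference of the codes. *)
pose g (d : {poly R}) := Num.sqrt (d.[a] ^+ 2 + d.[b] ^+ 2).
rewrite /distance_number; case: ex_minnP => m _ /(_ (size (edge_lengths p))) mP.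
apply: leq_trans (mP _) _; first by apply/asboolP; exists p.
rewrite -(size_map g D); apply: uniq_leq_size; first exact: undup_uniq.
move=> x; rewrite mem_undup => /mapP[[u v]]; rewrite mem_enum inE /= => uv ->.
apply/mapP; exists (f u - f v); first exact: fD.
by rewrite /distance !big_ord_recl big_ord0 addr0 /g !hornerE !mxE.
Qed.

Lemma distance_number_edgeless (R : realType) (G : sgraph) :
  (forall u v : G, ~~ edge u v) -> distance_number R G = 0%N.
Proof.
move=> noE; rewrite /distance_number.
case: ex_minnP => m /asboolP[p [_ <-]] _.
rewrite /edge_lengths [enum _](_ : _ = [::]) //.
apply/eqP; rewrite -size_eq0 -cardE; apply/eqP/eq_card0 => -[u v].
by rewrite inE /= (negPf (noE u v)).
Qed.

(* Along an edge of the drawing some coordinate of the coding changes by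
   exactly one, so no natural number lies strictly between its two values. *)
Lemma tree_partition_distance_number (R : realType) (G : sgraph) (w L : nat)
    (Rt : {set G}) :
  tree_partition w Rt setT -> (#|G| < 2 ^ L)%N ->
  (distance_number R G
     <= (L.+1 * (w * max_degree G).+1).*2.+1 * (w * w))%N.
Proof.
move=> tp GL; have [|f [fI fN _ _ fD]] := coding R tp (leqnn L).
  by rewrite cardsT.
rewrite -(size_differences R); apply: (distance_number_le (f := f)).
- by move=> u v; apply: fI; rewrite inE.
- move=> u v x t uv /andP[t0 t1]; apply/eqP => fx.
  have uvn : f u - f v != 0.
    rewrite subr_eq0; apply: contraTneq uv => /fI ->; rewrite ?inE //.
    by rewrite edge_irrefl.
  have [y yP] := differences_coef (fD _ _ (in_setT u) (in_setT v) uv) uvn.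
  have := congr1 (fun p : {poly R} => p`_(var_index y)) fx.
  rewrite /= coefD !coefZ; move: yP; rewrite coefB.
  have /natrP[a ->] := fN u (in_setT u) y.
  have /natrP[b ->] := fN v (in_setT v) y.
  have /natrP[c ->] := fN x (in_setT x) y.
  case=> ab cE.
    have ba : b%:R < c%:R :> R by nra.
    have ca : c%:R < b.+1%:R :> R by rewrite -natr1; nra.
    by move: ba ca; rewrite !ltr_nat; lia.
  have ba : a%:R < c%:R :> R by nra.
  have ca : c%:R < a.+1%:R :> R by rewrite -natr1; nra.
  by move: ba ca; rewrite !ltr_nat; lia.
- by move=> u v; apply: fD; rewrite inE.
Qed.

(** * The numerical bound *)

Lemma trunc_log2_ln (R : realType) (n : nat) :
  (0 < n)%N -> (trunc_log 2 n)%:R * ln 2 <= ln n%:R :> R.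
Proof.
move=> n0; rewrite mulr_natl -lnXn // ler_ln ?posrE ?exprn_gt0 ?ltr0n //.
by rewrite -natrX ler_nat; exact: trunc_logP.
Qed.

(** Some bag contains both ends of the edge. Positivity lets [k.+1] be absorbed into [2 * k] in the
    final estimate. *)
Lemma treewidth_gt0 (G : sgraph) (u v : G) : edge u v -> (0 < treewidth G)%N.
Proof.
move=> uv; rewrite /treewidth; case: ex_minnP => k /asboolP[T [bag [[_ edgeT _] <-]]] _.
have [t [ut vt]] := edgeT _ _ uv.
have : (1 < #|bag t|)%N.
  apply: leq_trans (_ : #|[set u; v]| <= _)%N.
    by rewrite cards2; case: eqP uv => // ->; rewrite edge_irrefl.
  by apply: subset_leq_card; apply/subsetP => z; rewrite !inE => /orP[] /eqP->.
rewrite /width; have := leq_bigmax (F := fun t => #|bag t|) t.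
by move=> le_max /leq_trans /(_ le_max); case: (\max_t _) => [|[|]].
Qed.

Theorem theorem19 (R : realType) :
  exists2 C : R, 0 < C &
    forall G : sgraph,
      (distance_number R G)%:R <=
        C * (max_degree G)%:R ^+ 4 * (treewidth G)%:R ^+ 3 * ln (#|G|%:R).
Proof.
have ln2 : 0 < ln 2 :> R by apply: ln_gt0; rewrite ltr1n.
(* The width [26 * k.+1 * D] is at most [52 * k * D] and enters cubed; 13 absorbs the additive
   constants in the number of differences, and [ln 2] converts the binary logarithm. *)
pose c := (13 * 52 ^ 3)%N.
exists (c%:R / ln 2); first by rewrite divr_gt0 // ltr0n.
move=> G; set n := #|G|; set D := max_degree G; set k := treewidth G.
have [/existsP[u /existsP[v uv]]|noE] := boolP [exists u : G, exists v : G, edge u v];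
  last first.
  rewrite distance_number_edgeless; last first.
    move=> u v; apply: contra noE => uv.
    by apply/existsP; exists u; apply/existsP; exists v.
  (* For the graph without vertices this uses the convention that [ln 0] is [0]. *)
  have lnn : 0 <= ln n%:R :> R.
    by case: n => [|n]; [rewrite ln0 // lexx|rewrite ln_ge0 // ler1n].
  by rewrite mulr_ge0 // -!natrX mulr_ge0 ?mulr_ge0 ?invr_ge0 ?ler0n // ltW.
have k0 : (0 < k)%N by exact: treewidth_gt0 uv.
have D0 : (0 < D)%N.
  apply: leq_trans (leq_bigmax (F := fun x : G => #|[set y | edge x y]|) u).
  apply/card_gt0P; exists v.
  by rewrite inE.
have n1 : (1 < n)%N.
  apply: leq_trans (_ : #|[set u; v]| <= _)%N; last exact: max_card.
  by rewrite cards2; case: eqP uv => // ->; rewrite edge_irrefl.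
have decG : has_decomposition_of_width G k.
  by rewrite /k /treewidth; case: ex_minnP => m /asboolP.
have [Rt tp] := exists_tree_partition D0 decG.
pose l := trunc_log 2 n.
have l0 : (0 < l)%N by rewrite trunc_log_gt0.
have dn := tree_partition_distance_number R tp (trunc_log_ltn n (ltnSn 1)).
have {}dn : (distance_number R G <= c * D ^ 4 * k ^ 3 * l)%N.
  apply: leq_trans dn _; rewrite -/D -/l.
  set w := (26 * k.+1 * D)%N.
  have w1 : (w <= 52 * k * D)%N by rewrite leq_mul2r; apply/orP; right; lia.
  have w0 : (0 < w * D)%N by rewrite !muln_gt0 D0.
  apply: leq_trans (_ : 13 * l * D * w ^ 3 <= _)%N.
    (* As [l] and [w * D] are positive, the factors are at most [3 * l] and [2 * (w * D)]; doubling
       gives 12, and the final successor makes it 13. *)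
    have : ((l.+2 * (w * D).+1).*2.+1 <= 13 * l * (w * D))%N by nia.
    move=> /(leq_mul (leqnn (w * w)))/=; rewrite mulnC; move/leq_trans; apply.
    by rewrite eq_leq //; ring.
  have w3 : (w ^ 3 <= (52 * k * D) ^ 3)%N by rewrite leq_exp2r.
  apply: leq_trans (leq_mul (leqnn _) w3) _.
  by rewrite eq_leq // /c !expnMn; ring.
apply: le_trans (_ : (c * D ^ 4 * k ^ 3 * l)%:R <= _); first by rewrite ler_nat.
have ll := trunc_log2_ln R (ltnW n1).
rewrite (natrM _ _ l) (natrM _ _ (k ^ 3)) (natrM _ c) !natrX.
have -> : c%:R / ln 2 * D%:R ^+ 4 * k%:R ^+ 3 * ln n%:R =
  c%:R * D%:R ^+ 4 * k%:R ^+ 3 * (ln n%:R / ln 2) :> R by ring.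
rewrite ler_wpM2l ?mulr_ge0 ?exprn_ge0 ?ler0n //.
by rewrite ler_pdivlMr.
Qed.
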